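(* Let $H^\omega$, $\Lambda_L$, $H^\omega_{\Lambda_L}$, $\beta_L$, $N_L^\omega$, $\tilde N_L^\omega$ be as in the context, and suppose $d\ge2$, $0<\alpha<\frac12$ and $1<\delta<\frac{1}{2\alpha}$. Then for every $E<-2d$, for almost all $\omega$, $$\frac{1}{2}\frac{1}{(2d-E)^{\delta-1}}\le\liminf_{L\to\infty}\frac{1}{\beta_L}N^\omega_L(E)\le\limsup_{L\to\infty}\frac{1}{\beta_L}N^\omega_L(E)\le\frac12\frac{1}{(-2d-E)^{\delta-1}},$$ and for every $E>2d$, for almost all $\omega$, $$\frac{1}{2}\frac{1}{(2d+E)^{\delta-1}}\le\liminf_{L\to\infty}\frac{1}{\beta_L}\tilde N^\omega_L(E)\le\limsup_{L\to\infty}\frac{1}{\beta_L}\tilde N^\omega_L(E)\le\frac12\frac{1}{(E-2d)^{\delta-1}}.$$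
   Context: Let $\{q_n\}_{n\in\mathbb{Z}^d}$ be i.i.d. real random variables on a probability space $(\Omega,\mathcal{B},\mathbb{P})$, whose common distribution $\mu$ has density $\rho(x)=0$ for $|x|<1$ and $\rho(x)=\frac{\delta-1}{2}|x|^{-\delta}$ for $|x|\ge1$, where $\delta>1$. Let $\{a_n\}_{n\in\mathbb{Z}^d}$ be positive reals with $a_n\simeq|n|^{-\alpha}$, $\alpha>0$ (i.e. there are constants $0<c_1\le c_2$ with $c_1|n|^{-\alpha}\le a_n\le c_2|n|^{-\alpha}$ for all $n\ne0$; $|\cdot|$ is the Euclidean norm). It is a standing assumption that $d-\alpha(\delta-1)>0$ (automatic under the hypotheses of the claim). On $\ell^2(\mathbb{Z}^d)$, with standard basis $\{\delta_n\}$, let $(\Delta u)(n)=\sum_{|m-n|=1}u(m)$ and $H^\omega=-\Delta+V^\omega$, where $(V^\omega u)(n)=a_nq_n(\omega)u(n)$. For $L\in\mathbb{N}$ let $\Lambda_L=\{n\in\mathbb{Z}^d:|n_i|\le L,\ i=1,\dots,d\}$ and let $H^\omega_{\Lambda_L}$ be the finite symmetric matrix $(\langle\delta_n,H^\omega\delta_m\rangle)_{n,m\in\Lambda_L}$. Put $\beta_L=\sum_{n\in\Lambda_L}a_n^{\delta-1}$ (which tends to $\infty$ as $L\to\infty$). With eigenvalues counted with multiplicity, $N_L^\omega(E)$ is the number of eigenvalues of $H^\omega_{\Lambda_L}$ that are $\le E$, and $\tilde N_L^\omega(E)$ is the number of eigenvalues of $H^\omega_{\Lambda_L}$ that are $\ge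 E$. ''Almost all $\omega$'' is with respect to $\mathbb{P}$. *)

(* Defs.v *)
From HB Require Import structures.
From mathcomp Require Import all_boot all_order all_algebra.
From mathcomp Require Import finmap.
From mathcomp Require Import all_classical all_reals all_analysis.
Set Implicit Arguments.
Unset Strict Implicit.
Unset Printing Implicit Defensive.
Import Order.TTheory GRing.Theory Num.Theory.
Import numFieldNormedType.Exports.
Local Open Scope classical_set_scope.
Local Open Scope ring_scope.

(* [Z^d] is represented by ['rV[int]_d]. *)

Definition enorm (R : realType) (d : nat) (n : 'rV[int]_d) : R :=
  Num.sqrt (\sum_(i < d) (n ord0 i)%:~R ^+ 2).

Definition box (d L : nat) : set 'rV[int]_d :=
  [set n | forall i : 'I_d, `|n ord0 i| <= L%:Z].
Arguments box : clear implicits.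

Definition nbrs (R : realType) (d : nat) (n : 'rV[int]_d) : set 'rV[int]_d :=
  [set m | enorm R (m - n) = 1].

(* The finitely supported sums [\sum_(i \in A)] and the finite sets [fset_set A]
   used below have their intended meaning because [box] and [nbrs] are finite. *)
Lemma finite_box (d L : nat) : finite_set (box d L).
Proof.
pose g (f : {ffun 'I_d -> 'I_(L + L).+1}) : 'rV[int]_d :=
  \row_i ((f i : nat)%:Z - L%:Z).
apply: (@sub_finite_set _ _ (g @` [set: {ffun 'I_d -> 'I_(L + L).+1}])).
  move=> n /= nL.
  exists [ffun i => inord (absz (n ord0 i + L%:Z))] => //.
  apply/rowP => i; rewrite mxE ffunE.
  have /andP[lo hi] : - L%:Z <= n ord0 i <= L%:Z by rewrite -ler_norml.
  have p0 : 0 <= n ord0 i + L%:Z by rewrite -lerBlDr sub0r.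
  have absE : (absz (n ord0 i + L%:Z))%:Z = n ord0 i + L%:Z by rewrite gez0_abs.
  rewrite inordK; first by rewrite absE addrK.
  by rewrite ltnS -lez_nat absE PoszD lerD2r.
exact/finite_image/finite_finset.
Qed.

Lemma finite_nbrs (R : realType) (d : nat) (n : 'rV[int]_d) :
  finite_set (nbrs R n).
Proof.
apply: (@sub_finite_set _ _ ((fun k => k + n) @` box d 1)); last first.
  exact/finite_image/finite_box.
move=> m /= mn1; exists (m - n); last by rewrite subrK.
move=> i; set k := m - n in mn1 *.
have s1 : \sum_(j < d) (k ord0 j)%:~R ^+ 2 = 1 :> R.
  have s0 : 0 <= \sum_(j < d) (k ord0 j)%:~R ^+ 2 :> R.
    by apply: sumr_ge0 => j _; exact: sqr_ge0.
  by rewrite -(sqr_sqrtr s0) -[Num.sqrt _]/(enorm R k) mn1 expr1n.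
have k1 : (k ord0 i)%:~R ^+ 2 <= 1 :> R.
  rewrite -[leRHS]s1 (bigD1 i)//= lerDl.
  by apply: sumr_ge0 => j _; exact: sqr_ge0.
move: k1; rewrite -real_normK ?num_real// -[leRHS](expr1n _ 2).
rewrite ler_pXn2r ?nnegrE// -intr_norm -[1 in leRHS]/(1%:~R).
by rewrite ler_int.
Qed.

Definition rho (R : realType) (delta x : R) : R :=
  if `|x| < 1 then 0 else (delta - 1) / 2 * `|x| `^ (- delta).

Definition has_density (R : realType) (dsp : measure_display)
    (T : measurableType dsp) (P : probability T R) (X : {RV P >-> R})
    (f : R -> R) : Prop :=
  forall A : set R, measurable A ->
    distribution P X A = (\int[lebesgue_measure]_(x in A) (f x)%:E)%E.

Definition independent_RVs (R : realType) (dsp : measure_display)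
    (T : measurableType dsp) (P : probability T R) (I : choiceType)
    (X : I -> {RV P >-> R}) : Prop :=
  forall (s : {fset I}) (B : I -> set R), (forall i, measurable (B i)) ->
    P (\bigcap_(i in [set` s]) (X i @^-1` B i)) =
    (\prod_(i <- s) P (X i @^-1` B i))%E.

(* [a_n ~ |n|^(-alpha)] in the two-sided sense; nothing is required at 0. *)
Definition decays_like (R : realType) (d : nat) (a : 'rV[int]_d -> R)
    (alpha : R) : Prop :=
  exists c1 c2 : R, [/\ 0 < c1, c1 <= c2 &
    forall n : 'rV[int]_d, n != 0 ->
      c1 * enorm R n `^ (- alpha) <= a n <= c2 * enorm R n `^ (- alpha)].

Definition delta_fun (R : realType) (d : nat) (n : 'rV[int]_d) :
    'rV[int]_d -> R :=
  fun k => (k == n)%:R.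

(* Only used when [u] is some [delta_fun n], so that the l^2 inner product is a
   finitely supported sum. *)
Definition inner (R : realType) (d : nat) (u v : 'rV[int]_d -> R) : R :=
  \sum_(k \in [set: 'rV[int]_d]) u k * v k.

Definition laplacian (R : realType) (d : nat) (u : 'rV[int]_d -> R) :
    'rV[int]_d -> R :=
  fun n => \sum_(m \in nbrs R n) u m.

(* [v] is the potential, i.e. [v n = a_n q_n(omega)]. *)
Definition schrodinger (R : realType) (d : nat) (v u : 'rV[int]_d -> R) :
    'rV[int]_d -> R :=
  fun n => - laplacian u n + v n * u n.

(* The sites of [box d L] are enumerated by [enum_val], in an arbitrary order;
   spectral data do not depend on it. *)
Definition schrodinger_box (R : realType) (d L : nat) (v : 'rV[int]_d -> R) :
    'M[R]_#|{: fset_set (box d L)}| :=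
  \matrix_(i, j) inner (delta_fun R (val (enum_val i)))
                       (schrodinger v (delta_fun R (val (enum_val j)))).

(* Number of eigenvalues lying in [A], each counted with the dimension of its
   eigenspace; applied to symmetric matrices only. *)
Definition eigen_count (R : realType) (m : nat) (M : 'M[R]_m) (A : set R) :
    nat :=
  \big[addn/0%N]_(x \in [set x | eigenvalue M x /\ A x])
    \rank (eigenspace M x).

Definition anderson (R : realType) (dsp : measure_display)
    (T : measurableType dsp) (P : probability T R) (d : nat)
    (a : 'rV[int]_d -> R) (q : 'rV[int]_d -> {RV P >-> R}) (w : T) (L : nat) :=
  @schrodinger_box R d L (fun n => a n * q n w).

Definition N_le (R : realType) (dsp : measure_display)
    (T : measurableType dsp) (P : probability T R) (d : nat)
    (a : 'rV[int]_d -> R) (q : 'rV[int]_d -> {RV P >-> R}) (w : T) (L : nat)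
    (E : R) : nat :=
  eigen_count (anderson a q w L) [set x | x <= E].

Definition N_ge (R : realType) (dsp : measure_display)
    (T : measurableType dsp) (P : probability T R) (d : nat)
    (a : 'rV[int]_d -> R) (q : 'rV[int]_d -> {RV P >-> R}) (w : T) (L : nat)
    (E : R) : nat :=
  eigen_count (anderson a q w L) [set x | E <= x].

Definition beta (R : realType) (d : nat) (a : 'rV[int]_d -> R) (delta : R)
    (L : nat) : R :=
  \sum_(n \in box d L) a n `^ (delta - 1).

(* Main.v *)
Require Import Defs.
From HB Require Import structures.
From mathcomp Require Import all_boot all_order all_algebra.
From mathcomp Require Import finmap complex ring lra zify.
From mathcomp Require Import all_classical all_reals all_analysis.
From mathcomp Require Import measurable_realfun.
Set Implicit Arguments.
Unset Strict Implicit.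
Unset Printing Implicit Defensive.
Import Order.TTheory GRing.Theory Num.Theory.
Import numFieldNormedType.Exports.
Local Open Scope classical_set_scope.
Local Open Scope ring_scope.

(* The off-diagonal part of the box matrix has row sums at most [2d], so by the
   min-max principle the eigenvalue counting function at [E] lies between the
   numbers of sites with [a_n q_n <= E - 2d] and with [a_n q_n <= E + 2d] (and
   symmetrically above [2d]).  For fixed [c > 0] the events [a_n q_n <= - c] are
   independent, of probability [1/2 (a_n / c)^(delta - 1)] for all but finitely
   many [n] since [a_n] tends to [0].  The number of such events in the box of
   size [L] thus has mean [1/2 c^(1 - delta) beta_L + O(1)] and variance at most
   its mean.  As [alpha (delta - 1) < 1/2] and [d >= 2], [beta_L] is at least a
   constant times [L^(3/2)], so the mean squares of the fluctuations divided by
   [beta_L] are summable in [L], and the fluctuations are almost surely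
   [o(beta_L)]. *)

(** * Hermitian forms and eigenvalue counting *)

(** The rows of [E] are the basis vectors indexed by [S]. The diagonal matrix factors through [E],
    which bounds its rank above, and [E *m diag_mx d] has the right inverse [G], which bounds it
    below. *)
Lemma mxrank_diag (F : fieldType) n (d : 'rV[F]_n) :
  \rank (diag_mx d) = #|[set i | d ord0 i != 0]%SET|.
Proof.
set S := [set i | _]%SET.
pose E : 'M[F]_(#|S|, n) := \matrix_(k, j) (enum_val k == j)%:R.
have Si (k : 'I_#|S|) : d ord0 (enum_val k) != 0.
  by have := enum_valP k; rewrite inE.
apply/eqP; rewrite eqn_leq; apply/andP; split.
  have -> : diag_mx d = (diag_mx d *m E^T) *m E.
    apply/matrixP => i j; rewrite -mulmxA !mul_diag_mx !mxE.
    case: (eqVneq (d ord0 i) 0) => [->|di]; first by rewrite mul0rn mul0r.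
    have iS : i \in S by rewrite inE.
    rewrite (bigD1 (enum_rank_in iS i))//= !mxE enum_rankK_in// eqxx mul1r.
    rewrite big1 ?addr0 ?mulr_natr// => k ki; rewrite !mxE.
    case: eqP => [ek|_]; last by rewrite mul0r.
    by case/eqP: ki; apply: enum_val_inj; rewrite enum_rankK_in.
  by apply: leq_trans (mxrankM_maxr _ _) _; exact: rank_leq_row.
pose G : 'M[F]_(n, #|S|) := \matrix_(j, k) ((j == enum_val k)%:R / d ord0 j).
suff EG : E *m diag_mx d *m G = 1%:M.
  rewrite -[leqLHS](mxrank1 F) -EG.
  by apply: leq_trans (mxrankM_maxl _ _) _; exact: mxrankM_maxr.
apply/matrixP => k k'; rewrite -mulmxA mul_diag_mx !mxE.
rewrite (bigD1 (enum_val k))//= !mxE eqxx mul1r mulrCA divff// mulr1.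
rewrite (inj_eq enum_val_inj) big1 ?addr0// => j jk.
by rewrite !mxE eq_sym (negbTE jk) mul0r.
Qed.

Section unitary.
Local Open Scope sesquilinear_scope.
Variables (C : numClosedFieldType) (n : nat).
Implicit Types (u : 'rV[C]_n) (l : 'rV[C]_n) (S B : {set 'I_n}).

Lemma hermitian_form_diag u l :
  (u *m diag_mx l *m u^t*) ord0 ord0 = \sum_i l ord0 i * `|u ord0 i| ^+ 2.
Proof.
rewrite mxE; apply: eq_bigr => i _.
by rewrite mul_mx_diag !mxE normCK mulrAC mulrC mulrA.
Qed.

Lemma hermitian_form1 u : (u *m u^t*) ord0 ord0 = \sum_i `|u ord0 i| ^+ 2.
Proof. by rewrite mxE; apply: eq_bigr => i _; rewrite !mxE normCK. Qed.

(* More unknowns than equations. *)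
Lemma supported_vanishing (U : 'M[C]_n) S B : (#|B| < #|S|)%N ->
  exists w : 'rV[C]_n, [/\ w != 0, forall i, i \notin S -> w ord0 i = 0 &
    forall j, j \in B -> (w *m U) ord0 j = 0].
Proof.
move=> BS.
pose K : 'M[C]_(#|S|, #|B|) := \matrix_(i, j) U (enum_val i) (enum_val j).
have : kermx K != 0.
  rewrite kermx_eq0 /row_free; apply/eqP => rK.
  by have := rank_leq_col K; rewrite rK leqNgt BS.
move=> /rowV0Pn[x /sub_kermxP xK x0].
pose E : 'M[C]_(#|S|, n) := \matrix_(k, j) (enum_val k == j)%:R.
have xE (k : 'I_#|S|) : (x *m E) ord0 (enum_val k) = x ord0 k.
  rewrite mxE (bigD1 k)//= !mxE eqxx mulr1 big1 ?addr0// => k' kk'.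
  by rewrite !mxE (inj_eq enum_val_inj) (negbTE kk') mulr0.
exists (x *m E); split.
- apply: contraNneq x0 => xE0; apply/eqP/rowP => k.
  by rewrite -xE xE0 !mxE.
- move=> i iS; rewrite mxE big1// => k _; rewrite !mxE.
  case: eqP => [ki|_]; last by rewrite mulr0.
  by move: iS; rewrite -ki enum_valP.
- move=> j jB.
  have xKj : (x *m K) ord0 (enum_rank_in jB j) = 0 by rewrite xK mxE.
  rewrite -xKj -mulmxA [LHS]mxE [RHS]mxE; apply: eq_bigr => k _; congr (_ * _).
  rewrite [RHS]mxE enum_rankK_in// !mxE (bigD1 (enum_val k))//= !mxE.
  rewrite eqxx mul1r big1 ?addr0// => i.
  by rewrite !mxE eq_sym => /negbTE->; rewrite mul0r.
Qed.

(** Min-max by a dimension count. If [S] were larger than [B], some nonzero vector would be a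
    combination of the eigenvectors indexed by [S] and vanish on [B]. Its quadratic form would be at
    most [t] times its squared norm by the spectral side, and strictly more by the bounds on [v] and
    [W]. *)
Lemma spectral_card_le (U W : 'M[C]_n) l v c t S B :
  U \is unitarymx ->
  invmx U *m diag_mx l *m U = diag_mx v + W ->
  (forall u, - c * (u *m u^t*) ord0 ord0 <= (u *m W *m u^t*) ord0 ord0) ->
  (forall i, i \in S -> l ord0 i <= t) ->
  (forall j, j \notin B -> t + c < v ord0 j) ->
  (#|S| <= #|B|)%N.
Proof.
move=> Uu UM Wc lt_ vt; rewrite leqNgt; apply/negP => BS.
have [w [w0 wS wB]] := supported_vanishing U BS.
pose u := w *m U.
have Uinv : U *m invmx U = 1%:M by rewrite mulmxV// unitarymx_unit.
have ut : u^t* = invmx U *m w^t*.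
  by rewrite /u trmx_mul map_mxM invmx_unitary.
have uu : (u *m u^t*) ord0 ord0 = (w *m w^t*) ord0 ord0.
  by rewrite ut mulmxA /u -(mulmxA w) Uinv mulmx1.
have uMu : (u *m (diag_mx v + W) *m u^t*) ord0 ord0 =
           (w *m diag_mx l *m w^t*) ord0 ord0.
  rewrite -UM ut /u !mulmxA -(mulmxA w U) Uinv mulmx1.
  by rewrite -!mulmxA (mulmxA U (invmx U)) Uinv mul1mx.
have le1 : (w *m diag_mx l *m w^t*) ord0 ord0 <= t * (u *m u^t*) ord0 ord0.
  rewrite uu hermitian_form_diag hermitian_form1 mulr_sumr; apply: ler_sum => i _.
  case: (boolP (i \in S)) => [/lt_ li|/wS->].
    by rewrite ler_wpM2r// exprn_ge0.
  by rewrite normr0 expr0n/= !mulr0.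
(* Every term of this sum is nonnegative, so all vanish. Off [B] the coefficient is positive, which
   forces [u = 0] and contradicts the invertibility of [U]. *)
have le2 : \sum_i (v ord0 i - c - t) * `|u ord0 i| ^+ 2 <= 0.
  rewrite (eq_bigr (fun i => v ord0 i * `|u ord0 i| ^+ 2 -
    (c + t) * `|u ord0 i| ^+ 2)); last first.
    by move=> i _; rewrite -mulrBl opprD addrA.
  rewrite sumrB -mulr_sumr -hermitian_form_diag -hermitian_form1.
  rewrite subr_le0 mulrDl -lerBlDl.
  apply: le_trans le1; rewrite -uMu mulmxDr mulmxDl [leRHS]mxE lerD2l.
  by rewrite -mulNr.
have ge j : 0 <= (v ord0 j - c - t) * `|u ord0 j| ^+ 2.
  case: (boolP (j \in B)) => [/wB->|/vt tj].
    by rewrite normr0 expr0n/= mulr0.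
  by rewrite mulr_ge0 ?exprn_ge0// -addrA -opprD subr_ge0 addrC ltW.
have /eqP := @le_anti _ _ _ 0 (introT andP (conj le2 (sumr_ge0 _ (fun j _ => ge j)))).
rewrite psumr_eq0 => [/allP u0|j _]; last exact: ge.
have {}u0 : u = 0.
  apply/rowP => j; rewrite [RHS]mxE.
  have := u0 j; rewrite mem_index_enum => /(_ isT).
  case: (boolP (j \in B)) => [/wB//|/vt tj].
  rewrite mulf_eq0 expf_eq0/= normr_eq0 => /orP[|/eqP//].
  by rewrite -addrA -opprD subr_eq0 addrC gt_eqF.
case/eqP: w0; rewrite -(mulmx1 w) -Uinv mulmxA.
by move: u0; rewrite /u => ->; rewrite mul0mx.
Qed.

(** The Schur test: each cross term is dominated by half of [|W i j| (|u_i|^2 + |u_j|^2)], and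
    symmetry turns row sums into column sums. *)
Lemma sym_form_ge (W : 'M[C]_n) c u :
  W^T = W -> (forall i j, W i j \is Num.real) ->
  (forall i, \sum_j `|W i j| <= c) ->
  - c * (u *m u^t*) ord0 ord0 <= (u *m W *m u^t*) ord0 ord0.
Proof.
move=> Wsym Wreal Wc.
have symE i j : W i j = W j i by rewrite -[in LHS]Wsym mxE.
have QE : (u *m W *m u^t*) ord0 ord0 =
    \sum_i \sum_j W i j * (u ord0 i * (u ord0 j)^*).
  rewrite mxE exchange_big/=; apply: eq_bigr => j _; rewrite !mxE mulr_suml.
  by apply: eq_bigr => i _; rewrite mulrAC mulrC mulrA.
have QE' : (u *m W *m u^t*) ord0 ord0 =
    \sum_i \sum_j W i j * (u ord0 j * (u ord0 i)^*).
  rewrite QE exchange_big/=; apply: eq_bigr => i _.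
  by apply: eq_bigr => j _; rewrite symE.
have NE : \sum_i \sum_j `|W i j| * `|u ord0 i| ^+ 2 <=
    c * (u *m u^t*) ord0 ord0.
  rewrite hermitian_form1 mulr_sumr; apply: ler_sum => i _.
  by rewrite -mulr_suml ler_wpM2r// exprn_ge0.
have NE' : \sum_i \sum_j `|W i j| * `|u ord0 i| ^+ 2 =
    \sum_i \sum_j `|W i j| * `|u ord0 j| ^+ 2.
  rewrite exchange_big/=; apply: eq_bigr => i _.
  by apply: eq_bigr => j _; rewrite symE.
(* Doubling lets each double sum be written once in each order of the indices, so that the summand
   becomes a weighted square. *)
suff H : 0 <= (u *m W *m u^t*) ord0 ord0 *+ 2 +
    (\sum_i \sum_j `|W i j| * `|u ord0 i| ^+ 2) *+ 2.
  rewrite mulNr -subr_ge0 opprK.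
  move: H; rewrite -mulrnDl pmulrn_lge0// => /le_trans; apply.
  by rewrite lerD2l.
rewrite !mulr2n {1}QE QE' {2}NE' -!big_split/=.
apply: sumr_ge0 => i _; rewrite -!big_split/=; apply: sumr_ge0 => j _.
(* [s] is the sign of [W i j], taken to be 1 at zero so that [s ^+ 2 = 1] always holds. *)
have [s [s2 sr Ws]] :
    exists s : C, [/\ s ^+ 2 = 1, s^* = s & W i j = s * `|W i j|].
  have /real_ge0P[w0|w0] := Wreal i j.
    by exists 1; rewrite expr1n rmorph1 mul1r.
  by exists (-1); rewrite sqrrN expr1n rmorphN1 mulrNN mul1r.
have -> : W i j * (u ord0 i * (u ord0 j)^*) +
    W i j * (u ord0 j * (u ord0 i)^*) +
    (`|W i j| * `|u ord0 i| ^+ 2 + `|W i j| * `|u ord0 j| ^+ 2) =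
    `|W i j| * `|u ord0 i + s * u ord0 j| ^+ 2.
  rewrite {1 2}Ws !normCK rmorphD rmorphM/= sr.
  rewrite -[ `|W i j| * (u ord0 j * _)]mul1r -s2; ring.
by rewrite mulr_ge0// exprn_ge0.
Qed.

End unitary.

(** [U] lives over the complex extension, where the spectral theorem is applied; [l] stays real so
    that eigenvalues can be compared with real thresholds. *)
Definition spectral_decomposition (R : rcfType) n (M : 'M[R]_n)
    (U : 'M[R[i]]_n) (l : 'rV[R]_n) : Prop :=
  U \is unitarymx /\
  map_mx (real_complex R) M =
    invmx U *m diag_mx (map_mx (real_complex R) l) *m U.

Lemma sym_spectral (R : rcfType) n (M : 'M[R]_n) :
  M^T = M -> exists U l, spectral_decomposition M U l.
Proof.
move=> Msym; set f := real_complex R; pose A := map_mx f M.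
have Aherm : A \is hermsymmx.
  apply: realsym_hermsym.
    apply/is_hermitianmxP; rewrite expr0 scale1r map_mx_id//.
    by rewrite /A map_trmx Msym.
  by apply/mxOverP => i j; rewrite mxE complex_real.
have /mxOverP lreal := hermitian_spectral_diag_real Aherm.
exists (spectralmx A), (map_mx (@complex.Re R) (spectral_diag A)).
split; first exact: spectral_unitarymx.
have -> : map_mx f (map_mx (@complex.Re R) (spectral_diag A)) = spectral_diag A.
  by apply/rowP => i; rewrite mxE mxE; exact: RRe_real.
exact: (orthomx_spectralP (hermitian_normalmx Aherm)).
Qed.

(** After conjugation by [U], [M - x] becomes the diagonal matrix of the [l_i - x]; neither this nor
    the extension of scalars changes the rank. *)
Lemma rank_eigenspace (R : rcfType) n (M : 'M[R]_n) U l x :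
  spectral_decomposition M U l ->
  \rank (eigenspace M x) = #|[set i | l ord0 i == x]|%SET.
Proof.
move=> [Uu ME]; rewrite /eigenspace mxrank_ker.
have Uunit := unitarymx_unit Uu.
rewrite -(mxrank_map (real_complex R)) map_mxB map_scalar_mx ME.
have -> : (real_complex R x)%:M = invmx U *m (real_complex R x)%:M *m U.
  by rewrite -mulmxA mul_scalar_mx -scalemxAr mulVmx// scalemx1.
rewrite -mulmxBl -mulmxBr mxrankMfree ?row_free_unit//.
rewrite (@eqmxMfull _ _ _ _ (invmx U)) ?row_full_unit ?unitmx_inv//.
rewrite -diag_const_mx -raddfB mxrank_diag.
set S := [set i | _]%SET; set S' := [set i | _]%SET.
have -> : S = (~: S')%SET.
  apply/setP => i; rewrite !inE !mxE subr_eq0.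
  by rewrite (inj_eq (@complexI R)).
by have := cardsC S'; rewrite card_ord => {1}<-; rewrite addnK.
Qed.

(** Multiplicities are written as sums over indices and the two sums are exchanged: an index [i]
    contributes only at the eigenvalue [l_i]. *)
Lemma eigen_countE (R : realType) n (M : 'M[R]_n) U l (A : set R) :
  spectral_decomposition M U l ->
  eigen_count M A = #|[set i | l ord0 i \in A]|%SET.
Proof.
move=> Ul; rewrite /eigen_count; set X := [set x | eigenvalue M x /\ A x].
have eigE x : eigenvalue M x = [exists i, l ord0 i == x].
  rewrite /eigenvalue -mxrank_eq0 (rank_eigenspace x Ul) -lt0n card_gt0.
  apply/set0Pn/existsP => -[i li]; exists i; first by rewrite inE in li.
  by rewrite inE.
have Xfin : finite_set X.
  apply: (@sub_finite_set _ _ [set l ord0 i | i in [set: 'I_n]]).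
    by move=> x [+ _]; rewrite eigE => /existsP[i /eqP <-]; exists i.
  exact/finite_image/finite_finset.
rewrite fsbig_finite//=.
under eq_bigr do rewrite (rank_eigenspace _ Ul) -sum1dep_card big_mkcond/=.
rewrite exchange_big/= -sum1dep_card [RHS]big_mkcond/=; apply: eq_bigr => i _.
rewrite -big_mkcond/= (eq_bigl (pred1 (l ord0 i))); last first.
  by move=> x; rewrite /= eq_sym.
case: ifPn => lA.
  rewrite -big_filter filter_pred1_uniq ?big_seq1 ?fset_uniq//.
  rewrite in_fset_set// inE; split; last exact: set_mem.
  by rewrite eigE; apply/existsP; exists i.
rewrite big_seq_cond big1// => x /andP[xX /eqP xl]; move: xX.
rewrite in_fset_set// inE xl => -[_ /mem_set].
by rewrite (negbTE lA).
Qed.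

Lemma map_sum_norm (R : rcfType) n (W : 'M[R]_n) i :
  \sum_j `|map_mx (real_complex R) W i j| = (\sum_j `|W i j|)%:C%C.
Proof.
rewrite rmorph_sum; apply: eq_bigr => j _.
by rewrite mxE normc_def/= expr0n/= addr0 sqrtr_sqr.
Qed.

Lemma card_spectrum_le (R : rcfType) n (M W : 'M[R]_n) U l (v : 'rV[R]_n) c
    (S B : {set 'I_n}) :
  spectral_decomposition M U l ->
  M = diag_mx v + W -> W^T = W -> (forall i, \sum_j `|W i j| <= c) ->
  (forall i j, i \in S -> j \notin B -> l ord0 i + c < v ord0 j) ->
  (#|S| <= #|B|)%N.
Proof.
move=> [Uu ME] Mv Wsym Wc lv.
have [->|[i0 i0S]] := set_0Vmem S; first by rewrite cards0.
(* The largest [l_i] over [S] is the threshold [t] needed by [spectral_card_le]. *)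
pose i1 := [arg max_(i > i0 | i \in S) l ord0 i]%O.
have [i1S lmax] : i1 \in S /\ forall i, i \in S -> l ord0 i <= l ord0 i1.
  by rewrite /i1; case: Order.TotalTheory.arg_maxP.
pose f := real_complex R.
apply: (@spectral_card_le _ _ U (map_mx f W) (map_mx f l) (map_mx f v) (f c)
  (f (l ord0 i1))) => //.
- by rewrite -ME Mv map_mxD map_diag_mx.
- move=> u; apply: sym_form_ge.
  + by rewrite map_trmx Wsym.
  + by move=> i j; rewrite mxE complex_real.
  + by move=> i; rewrite map_sum_norm lecR.
- by move=> i /lmax; rewrite !mxE lecR.
- by move=> j jB; rewrite !mxE -rmorphD ltcR lv.
Qed.

Lemma spectral_decompositionN (R : rcfType) n (M : 'M[R]_n) U l :
  spectral_decomposition M U l -> spectral_decomposition (- M) U (- l).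
Proof.
move=> [Uu ME]; split; first exact: Uu.
by rewrite map_mxN ME map_mxN raddfN mulmxN mulNmx.
Qed.

(** Weyl-type bounds. All four come from [card_spectrum_le], applied to [M] or [- M]; the lower
    bounds on the eigenvalue counts compare complements. *)
Lemma eigen_count_diag_perturb (R : realType) n (M W : 'M[R]_n) (v : 'rV[R]_n)
    (c t : R) :
  M = diag_mx v + W -> W^T = W -> (forall i, \sum_j `|W i j| <= c) ->
  [/\ (eigen_count M [set x | (x <= t)%R] <=
       #|[set i | (v ord0 i <= t + c)%R]%SET|)%N,
      (#|[set i | (v ord0 i <= t - c)%R]%SET| <=
       eigen_count M [set x | (x <= t)%R])%N,
      (eigen_count M [set x | (t <= x)%R] <=
       #|[set i | (t - c <= v ord0 i)%R]%SET|)%N &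
      (#|[set i | (t + c <= v ord0 i)%R]%SET| <=
       eigen_count M [set x | (t <= x)%R])%N].
Proof.
move=> Mv Wsym Wc.
have Msym : M^T = M by rewrite Mv linearD/= tr_diag_mx Wsym.
have [U [l Ul]] := sym_spectral Msym; rewrite !(eigen_countE _ Ul).
have NUl := spectral_decompositionN Ul.
have NMv : - M = diag_mx (- v) + (- W) by rewrite Mv opprD raddfN.
have NWsym : (- W)^T = - W by rewrite linearN/= Wsym.
have NWc i : \sum_j `|(- W) i j| <= c.
  by under eq_bigr do rewrite mxE normrN.
have memE (p : pred R) : [set i | l ord0 i \in [set x | p x]%classic]%SET =
    [set i | p (l ord0 i)]%SET.
  by apply/setP => i; rewrite !inE mem_setE.
have cardC (p q : pred 'I_n) : (#|~: [set i | p i]| <= #|~: [set i | q i]| ->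
    #|[set i | q i]| <= #|[set i | p i]|)%SET%N.
  by move=> pq; rewrite cardsCs [leqRHS]cardsCs leq_sub2l.
rewrite !memE; split.
- apply: (card_spectrum_le Ul Mv Wsym Wc) => i j; rewrite !inE; lra.
- apply: cardC; apply: (card_spectrum_le NUl NMv NWsym NWc) => i j.
  rewrite !inE !mxE; lra.
- apply: (card_spectrum_le NUl NMv NWsym NWc) => i j; rewrite !inE !mxE; lra.
- apply: cardC; apply: (card_spectrum_le Ul Mv Wsym Wc) => i j.
  rewrite !inE; lra.
Qed.

(** * The matrix of a box *)

Lemma nbrs_sym (R : realType) d (n m : 'rV[int]_d) : nbrs R n m -> nbrs R m n.
Proof.
rewrite /nbrs/= /enorm -(opprB n m) => nm.
rewrite -[RHS]nm; congr Num.sqrt; apply: eq_bigr => i _.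
by rewrite [in RHS]mxE mulrNz sqrrN.
Qed.

(** Integer squares that sum to 1 consist of a single 1 and zeros. The pairs [k] serve to count at
    most [2d] neighbours. *)
Lemma nbrs_unit (R : realType) d (n m : 'rV[int]_d) : nbrs R n m ->
  exists k : 'I_d * bool, m = n + (-1) ^+ k.2 *: delta_mx ord0 k.1.
Proof.
rewrite /nbrs/= -{2}(subrK n m) => mn1; rewrite addrC.
move: (m - n) mn1 => k mn1.
have s1 : \sum_(j < d) (k ord0 j) ^+ 2 = 1.
  apply: (@mulrIz R 1); first exact: oner_neq0.
  rewrite -[RHS](expr1n _ 2) -[in RHS]mn1 /enorm sqr_sqrtr; last first.
    by apply: sumr_ge0 => j _; exact: sqr_ge0.
  by rewrite rmorph_sum; apply: eq_bigr => j _; rewrite rmorphXn.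
have [i ki|k0] := pickP (fun i => k ord0 i != 0); last first.
  move: s1; rewrite big1// => j _.
  by have /eqP-> := negbFE (k0 j).
have ge1 : 1 <= k ord0 i ^+ 2 by rewrite -gtz0_ge1 lt0r sqr_ge0 expf_neq0.
have rest0 : \sum_(j < d | j != i) (k ord0 j) ^+ 2 = 0.
  apply/eqP; rewrite eq_le sumr_ge0 ?andbT => [|j _]; last exact: sqr_ge0.
  move: s1 ge1; rewrite (bigD1 i)//=.
  by move: (k ord0 i ^+ 2) (\sum_(j < d | _) _) => x y; lia.
have ki1 : k ord0 i ^+ 2 = 1 by move: s1; rewrite (bigD1 i)//= rest0 addr0.
have kj0 j : j != i -> k ord0 j = 0.
  move=> ji; move/eqP: rest0; rewrite psumr_eq0 => [/allP/(_ j)|*];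
    last exact: sqr_ge0.
  by rewrite mem_index_enum ji/= sqrf_eq0 => /(_ isT)/eqP.
(* The boolean records whether the nonzero coordinate is negative. *)
exists (i, k ord0 i == -1); congr (_ + _).
apply/rowP => j; rewrite !mxE eqxx/=.
have [->|ji] := eqVneq j i; last by rewrite kj0// mulr0.
move/eqP: ki1; rewrite -subr_eq0 subr_sqr_1 mulf_eq0 subr_eq0 addr_eq0.
by case/orP => /eqP->.
Qed.

Section box_matrix.
Variables (R : realType) (d L : nat) (v : 'rV[int]_d -> R).
Local Notation I := 'I_#|{: fset_set (box d L)}|.

Definition site (i : I) : 'rV[int]_d := val (enum_val i).

Lemma site_inj : injective site.
Proof. by move=> i j /val_inj /enum_val_inj. Qed.

(** The restriction of minus the Laplacian to the box: bonds that leave the box are dropped. *)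
Definition hopping : 'M[R]_#|{: fset_set (box d L)}| :=
  \matrix_(i, j) - (site j \in nbrs R (site i))%:R.

Lemma hopping_sym : hopping^T = hopping.
Proof.
apply/matrixP => i j; rewrite !mxE; congr (- (nat_of_bool _)%:R).
by apply/idP/idP => /set_mem/nbrs_sym/mem_set.
Qed.

(** Each neighbour has the form [f k], and by injectivity of [site] each of the [2d] values of [k]
    accounts for at most one index. *)
Lemma hopping_bound i : \sum_j `|hopping i j| <= 2 * d%:R.
Proof.
under eq_bigr do rewrite mxE normrN normr_nat.
rewrite -natr_sum -natrM ler_nat.
pose f (k : 'I_d * bool) := site i + (-1) ^+ k.2 *: delta_mx ord0 k.1.
have -> : (2 * d = #|{: 'I_d * bool}|)%N.
  by rewrite card_prod card_ord card_bool mulnC.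
apply: (@leq_trans (\sum_j \sum_(k : 'I_d * bool) (site j == f k))%N).
  apply: leq_sum => j _; case: (boolP (_ \in _)) => //= /set_mem/nbrs_unit[k jk].
  by rewrite (bigD1 k)//= jk eqxx.
rewrite exchange_big/= -[leqRHS]sum1_card; apply: leq_sum => k _.
rewrite -big_mkcond sum1_card; apply/card_le1_eqP => j j' jf j'f.
by apply: site_inj; rewrite [LHS](eqP (j'f : site j' == f k))
  (eqP (jf : site j == f k)).
Qed.

Lemma schrodinger_boxE :
  schrodinger_box L v = diag_mx (\row_i v (site i)) + hopping.
Proof.
apply/matrixP => i j; rewrite !mxE /inner -!/(site _).
rewrite -(fsbig_widen [set site i])//= => [|k [_ /eqP/negbTE]]; last first.
  by move=> ki; rewrite /= /delta_fun ki mul0r.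
rewrite fsbig_set1 {1}/delta_fun eqxx mul1r /schrodinger /laplacian addrC.
congr (_ + _); last first.
  by rewrite /delta_fun (inj_eq site_inj) mulr_natr.
congr (- _); case: (boolP (_ \in _)) => [/set_mem ji|ji].
  rewrite -(fsbig_widen [set site j])/= => [||k [_ /eqP/negbTE]].
  - by rewrite fsbig_set1 /delta_fun eqxx.
  - by move=> _ ->.
  - by move=> kj; rewrite /= /delta_fun kj.
rewrite fsbig1// => k ki; rewrite /delta_fun; case: eqP => // kj.
by move: ji; rewrite -kj mem_set.
Qed.

(** Passes from matrix indices to lattice sites, which removes the arbitrary enumeration from the
    counts. *)
Lemma card_site (p : pred 'rV[int]_d) :
  #|[set i | p (site i)]%SET| = (\sum_(n <- fset_set (box d L)) p n)%N.
Proof.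
rewrite -sum1dep_card big_mkcond/= (reindex enum_rank) /=; last first.
  by exists enum_val => k _; [exact: enum_rankK|exact: enum_valK].
rewrite big_seq_fsetE/=; apply: eq_bigr => x _.
by rewrite /site enum_rankK; case: (p _).
Qed.

End box_matrix.

(** * The weights *)

Lemma abs_le_enorm (R : realType) d (n : 'rV[int]_d) i :
  `|n ord0 i|%:~R <= enorm R n.
Proof.
rewrite /enorm -[leLHS]ger0_norm ?ler0z// -sqrtr_sqr ler_sqrt; last first.
  by apply: sumr_ge0 => j _; exact: sqr_ge0.
rewrite intr_norm real_normK ?num_real// (bigD1 i)//= lerDl.
by apply: sumr_ge0 => j _; exact: sqr_ge0.
Qed.

Lemma enorm_gt0 (R : realType) d (n : 'rV[int]_d) : n != 0 -> 0 < enorm R n.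
Proof.
move=> n0; have /existsP[i ni] : [exists i, n ord0 i != 0].
  rewrite -negb_forall; apply: contra n0 => /forallP n0.
  by apply/eqP/rowP => i; rewrite mxE; exact/eqP.
by apply: lt_le_trans (abs_le_enorm R n i); rewrite ltr0z normr_gt0.
Qed.

(** The factor [d] is cruder than its square root, but only the power of [L] matters below. *)
Lemma enorm_box (R : realType) d L (n : 'rV[int]_d) :
  box d L n -> enorm R n <= d%:R * L%:R.
Proof.
move=> nL; rewrite /enorm -[leRHS]ger0_norm ?mulr_ge0// -sqrtr_sqr.
rewrite ler_sqrt ?sqr_ge0//.
apply: (@le_trans _ _ (\sum_(i < d) L%:R ^+ 2)).
  apply: ler_sum => i _; rewrite -real_normK ?num_real// -intr_norm.
  by rewrite ler_pXn2r ?nnegrE ?ler0z// -[L%:R]/(L%:~R) ler_int; exact: nL.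
rewrite sumr_const card_ord -[leLHS]mulr_natl exprMn ler_wpM2r ?sqr_ge0//.
by rewrite -natrX ler_nat -{1}(expn1 d); case: (d) => // k; rewrite leq_pexp2l.
Qed.

(** For square roots of consecutive integers this bounds [x^-3] by a telescoping difference. It
    amounts to [y (x + y) <= 6 x^2], which follows from [y <= 2 x]; hence the constant 6. *)
Lemma inv_sqrt_telescope (R : realFieldType) (x y : R) : 1 <= x -> 0 < y ->
  y ^+ 2 = x ^+ 2 + 1 -> (x ^+ 3)^-1 + 6 / y <= 6 / x.
Proof.
move=> x1 y0 yx; have x0 : 0 < x by lra.
have y2x : y <= 2 * x by rewrite -(ler_pXn2r (n := 2))// ?nnegrE; nra.
have xy : y <= 6 * x ^+ 2 * (y - x).
  rewrite -(ler_pM2r (addr_gt0 x0 y0)); nra.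
rewrite -subr_ge0 (_ : _ - _ = (6 * x ^+ 2 * (y - x) - y) / (x ^+ 3 * y)).
  by rewrite divr_ge0 ?subr_ge0// ltW// mulr_gt0// exprn_gt0.
by field; rewrite !gt_eqF.
Qed.

Section weights.
Variables (R : realType) (d : nat) (a : 'rV[int]_d -> R) (alpha delta : R).
Hypotheses (alpha_gt0 : 0 < alpha) (ha_pos : forall n, 0 < a n)
  (ha : decays_like a alpha).

Lemma decays_like_cvg0 e : 0 < e ->
  exists M, forall n, ~ box d M n -> a n <= e.
Proof.
move=> e0; have [c1 [c2 [c10 c12 aP]]] := ha.
have c20 : 0 < c2 by exact: lt_le_trans c12.
have ce0 : 0 < c2 / e by rewrite divr_gt0.
(* The radius at which the upper bound [c2 x^(-alpha)] equals [e]. *)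
pose x := (c2 / e) `^ alpha^-1.
have x0 : 0 < x by rewrite powR_gt0.
exists (Num.bound x) => n nM.
have /existsP[i ni] : [exists i, (Num.bound x)%:Z < `|n ord0 i|].
  rewrite -[X in is_true X]negbK; apply/negP => /existsPn H.
  by apply: nM => i; rewrite leNgt; exact: H.
have n0 : n != 0.
  by apply: contraTneq ni => ->; rewrite mxE normr0.
have xn : x <= enorm R n.
  apply: le_trans (abs_le_enorm R n i).
  apply: (@le_trans _ _ (Num.bound x)%:R).
    by apply/ltW/archi_boundP/ltW.
  by rewrite -[(_%:R)]/((Num.bound x)%:Z%:~R) ler_int ltW.
have /andP[_] := aP _ n0; move=> /le_trans; apply.
rewrite powRN ler_pdivrMr ?powR_gt0 ?enorm_gt0// -ler_pdivrMl//.
apply: (@le_trans _ _ (x `^ alpha)).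
  by rewrite /x -powRrM mulVf ?gt_eqF// powRr1 ?(ltW ce0)// mulrC.
by rewrite ge0_ler_powR ?nnegrE ?(ltW alpha_gt0)// ltW// enorm_gt0.
Qed.

Hypotheses (hd : (2 <= d)%N) (delta1 : 1 < delta)
  (alpha_delta : alpha * (delta - 1) <= 1 / 2).

(** The origin lies in every box, including [L = 0], so division by [beta] is always meaningful. *)
Lemma beta_gt0 L : 0 < beta a delta L.
Proof.
rewrite /beta fsbig_finite/=; last exact: finite_box.
have H0 : 0 \in fset_set (box d L).
  by rewrite in_fset_set ?inE; [move=> i; rewrite mxE normr0|exact: finite_box].
rewrite (big_fsetD1 0)//= ltr_wpDr ?powR_gt0//.
by apply: sumr_ge0 => n _; exact: powR_ge0.
Qed.

(** The sites whose first two coordinates range over [1..L] and whose others vanish. Starting at 1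
    avoids the origin, where [decays_like] gives no bound. *)
Lemma card_box_ge L : exists2 T : seq 'rV[int]_d, (uniq T /\ size T = L ^ 2)%N &
  forall n, n \in T -> n != 0 /\ box d L n.
Proof.
case: d hd => [//|[//|k]] _.
pose g (p : 'I_L * 'I_L) : 'rV[int]_k.+2 :=
  \row_i (if i == ord0 then p.1.+1%:Z else if i == 1 then p.2.+1%:Z else 0).
have ginj : injective g.
  move=> [i j] [i' j'] /rowP gE.
  have := gE ord0; have := gE 1; rewrite !mxE/= => -[/val_inj<-] [/val_inj<-].
  by [].
exists [seq g p | p : 'I_L * 'I_L]; first split.
- by rewrite map_inj_uniq// enum_uniq.
- by rewrite size_map -cardE card_prod card_ord.
move=> n /mapP[p _ ->]; split.
  by apply/eqP => /rowP/(_ ord0); rewrite !mxE/=.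
move=> i; rewrite mxE; case: ifP => _; first by rewrite ger0_norm// lez_nat.
by case: ifP => _; rewrite ?normr0// ger0_norm// lez_nat.
Qed.

(** Each of the [L^2] sites above contributes at least a constant times [(d L)^(-1/2)], because
    [alpha (delta - 1) <= 1/2] and [d L >= 1]. The total is of order [L^(3/2)]. *)
Lemma beta_ge : exists2 c : R, 0 < c &
  forall L : nat, c * (L%:R * Num.sqrt L%:R) <= beta a delta L.
Proof.
have [c1 [c2 [c10 c12 aP]]] := ha.
have d0 : 0 < d%:R :> R by rewrite ltr0n; lia.
pose c := c1 `^ (delta - 1) / Num.sqrt d%:R.
have c0 : 0 < c by rewrite divr_gt0 ?powR_gt0// sqrtr_gt0.
exists c => // -[|L']; first by rewrite mul0r mulr0 ltW// beta_gt0.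
set L := L'.+1; have L0 : 0 < L%:R :> R by rewrite ltr0n.
have [T [Tuniq Tsize] Tbox] := card_box_ge L.
rewrite /beta fsbig_finite/=; last exact: finite_box.
have lb n : n \in T -> c / Num.sqrt L%:R <= a n `^ (delta - 1).
  move=> /Tbox[n0 nL]; have /andP[an _] := aP _ n0.
  have dL0 : 0 < d%:R * L%:R :> R by rewrite mulr_gt0.
  have dL1 : 1 <= d%:R * L%:R :> R by rewrite -natrM ler1n muln_gt0; lia.
  apply: (@le_trans _ _ ((c1 * (d%:R * L%:R) `^ (- alpha)) `^ (delta - 1))).
    rewrite powRM ?powR_ge0 ?(ltW c10)// /c -mulrA ler_wpM2l ?powR_ge0//.
    rewrite -invfM -sqrtrM ?ler0n// -powR12_sqrt ?(ltW dL0)// -powRrM mulNr powRN.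
    by rewrite lef_pV2 ?posrE ?powR_gt0// ler_powR// -[2^-1]mul1r.
  apply: ge0_ler_powR; rewrite ?nnegrE ?subr_ge0 ?(ltW delta1) ?(ltW (ha_pos n))//.
    by rewrite mulr_ge0 ?powR_ge0 ?(ltW c10).
  apply: le_trans an; rewrite ler_wpM2l ?(ltW c10)// !powRN.
  rewrite lef_pV2 ?posrE ?powR_gt0 ?enorm_gt0//.
  rewrite ge0_ler_powR ?nnegrE ?(ltW alpha_gt0)//.
  - by rewrite ltW ?enorm_gt0.
  - exact: enorm_box.
have -> : c * (L%:R * Num.sqrt L%:R) = (L ^ 2)%:R * (c / Num.sqrt L%:R).
  have s0 : Num.sqrt L%:R != 0 :> R by rewrite gt_eqF ?sqrtr_gt0.
  have Ls : L%:R = Num.sqrt L%:R ^+ 2 :> R by rewrite sqr_sqrtr ?ltW.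
  rewrite natrX; move: (Num.sqrt L%:R) s0 Ls => s s0 ->; field.
  exact: s0.
rewrite -Tsize (bigID (mem T))/= -[leLHS]addr0 lerD//; last first.
  by apply: sumr_ge0 => n _; exact: powR_ge0.
apply: (@le_trans _ _
  (\sum_(n <- fset_set (box d L) | n \in T) (c / Num.sqrt L%:R))).
  rewrite big_const_seq iter_addr addr0 -[leRHS]mulr_natl ler_wpM2r//.
    exact/divr_ge0/sqrtr_ge0/ltW.
  rewrite ler_nat -size_filter uniq_leq_size// => n nT.
  rewrite mem_filter nT in_fset_set; last exact: finite_box.
  by rewrite inE; have [] := Tbox _ nT.
by apply: ler_sum => n; exact: lb.
Qed.

Lemma summable_beta : (\sum_(0 <= L <oo) ((beta a delta L)^-1)%:E < +oo)%E.
Proof.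
have [c c0 cb] := beta_ge.
pose K := 6 / c; have K0 : 0 < K by rewrite divr_gt0.
pose b L := (beta a delta L)^-1.
have b0 L : 0 <= b L by rewrite invr_ge0 ltW ?beta_gt0.
have step (L : nat) : b L.+1 + K / Num.sqrt L.+2%:R <= K / Num.sqrt L.+1%:R.
  have x0 : 0 < Num.sqrt L.+1%:R :> R by rewrite sqrtr_gt0.
  have y0 : 0 < Num.sqrt L.+2%:R :> R by rewrite sqrtr_gt0.
  have L1 : 1 <= Num.sqrt L.+1%:R :> R by rewrite -[leLHS]sqrtr1 ler_sqrt ?ler1n.
  have /(inv_sqrt_telescope L1 y0) :
      Num.sqrt L.+2%:R ^+ 2 = Num.sqrt L.+1%:R ^+ 2 + 1 :> R.
    by rewrite !sqr_sqrtr// natr1.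
  move=> xy; have xL : Num.sqrt L.+1%:R ^+ 2 = L.+1%:R :> R by rewrite sqr_sqrtr.
  have bx : b L.+1 <= c^-1 * (Num.sqrt L.+1%:R ^+ 3)^-1.
    rewrite -invfM lef_pV2 ?posrE ?beta_gt0 ?mulr_gt0 ?exprn_gt0//.
    by apply: le_trans (cb L.+1); rewrite -{2}xL exprSr.
  apply: (le_trans (lerD bx (lexx _))).
  have KE (z : R) : K / z = c^-1 * (6 / z) by rewrite /K mulrAC mulrC.
  by rewrite !KE -mulrDr ler_pM2l// invr_gt0.
(* The term at [L = 0] is set apart, since the lower bound of [beta_ge] is trivial there; the others
   telescope by [step]. *)
have bound n : \sum_(0 <= L < n.+1) b L + K / Num.sqrt n.+1%:R <= b 0%N + K.
  elim: n => [|n IH]; first by rewrite big_nat1 sqrtr1 divr1.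
  by rewrite big_nat_recr//= -addrA; apply: le_trans IH; rewrite lerD2l.
apply: (@le_lt_trans _ _ (b 0%N + K)%:E); last exact: ltry.
apply: lime_le; first by apply: is_cvg_nneseries => n _ _; rewrite lee_fin; exact: b0.
apply: nearW => n; rewrite sumEFin lee_fin.
apply: (@le_trans _ _ (\sum_(0 <= L < n.+1) b L)).
  by rewrite big_nat_recr//= lerDl.
by apply: le_trans (bound n); rewrite lerDl divr_ge0 ?ltW// sqrtr_gt0.
Qed.

End weights.

(** * Second moments and almost sure limits *)

Lemma cvg_nneseries_0 (R : realType) (u : R^nat) : (forall n, 0 <= u n) ->
  (\sum_(0 <= n <oo) (u n)%:E < +oo)%E -> u @ \oo --> 0.
Proof.
move=> u0 uoo; apply: cvg_series_cvg_0.
apply: nondecreasing_is_cvgn; first exact: nondecreasing_series.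
exists (fine (\sum_(0 <= n <oo) (u n)%:E)%E) => _ [n _ <-].
rewrite -lee_fin fineK; last first.
  by rewrite ge0_fin_numE//; apply: nneseries_ge0 => k _ _; rewrite lee_fin.
rewrite /series/= -sumEFin; apply: nneseries_lim_ge => k _ _.
by rewrite lee_fin.
Qed.

Section second_moment.
Context (R : realType) (dsp : measure_display) (T : measurableType dsp)
  (P : probability T R) (I : choiceType) (A : I -> set T) (p : I -> R).
Hypotheses (mA : forall i, measurable (A i)) (pA : forall i, P (A i) = (p i)%:E)
  (indepA : forall i j, i != j -> P (A i `&` A j) = (p i * p j)%:E).

Definition hits (s : seq I) (w : T) : R := \sum_(i <- s) \1_(A i) w.

Lemma measurable_hits s : measurable_fun setT (hits s).
Proof. by apply: measurable_sum => i; exact: measurable_indic. Qed.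

Lemma event_prob_ge0 i : 0 <= p i.
Proof. by rewrite -lee_fin -pA. Qed.

Lemma integral_hits s : (\int[P]_w (hits s w)%:E = (\sum_(i <- s) p i)%:E)%E.
Proof.
under eq_integral do rewrite /hits -sumEFin.
rewrite ge0_integral_sum//=; last first.
  by move=> i; apply/measurable_EFinP; exact: measurable_indic.
rewrite -sumEFin; apply: eq_bigr => i _.
by rewrite integral_indic// setIT; exact: pA.
Qed.

(** In the expanded square a diagonal pair contributes [p i] and any other pair [p i * p j], so
    pairwise independence suffices; adding the diagonal terms [p i ^+ 2] completes the square of the
    mean. *)
Lemma integral_hits_sqr s : uniq s ->
  (\int[P]_w (hits s w ^+ 2)%:E <=
   ((\sum_(i <- s) p i) ^+ 2 + \sum_(i <- s) p i)%:E)%E.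
Proof.
move=> us.
have -> : (fun w => (hits s w ^+ 2)%:E) =
    (fun w => \sum_(k <- [seq (i, j) | i <- s, j <- s])
      (\1_(A k.1 `&` A k.2) w)%:E)%E.
  apply/funext => w; rewrite sumEFin big_allpairs expr2 mulr_suml; congr EFin.
  apply: eq_bigr => i _; rewrite mulr_sumr; apply: eq_bigr => j _.
  by rewrite indicI.
rewrite ge0_integral_sum//=; last first.
  by move=> i; apply/measurable_EFinP; apply: measurable_indic; exact: measurableI.
under eq_bigr do (rewrite integral_indic ?setIT//; last exact: measurableI).
rewrite big_allpairs/= expr2 mulr_suml -big_split/= -sumEFin big_seq [leRHS]big_seq.
apply: lee_sum => i si; rewrite (bigD1_seq i)//= setIid [X in (X + _)%E]pA addeC.
rewrite EFinD leeD2r// mulr_sumr -sumEFin [leRHS](bigD1_seq i)//=.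
rewrite -[leLHS]add0e leeD//; first by rewrite lee_fin mulr_ge0 ?event_prob_ge0.
by apply: lee_sum => j ji; rewrite [leLHS]indepA// eq_sym.
Qed.

Lemma second_moment_hits s : uniq s ->
  (\int[P]_w ((hits s w - \sum_(i <- s) p i) ^+ 2)%:E <= (\sum_(i <- s) p i)%:E)%E.
Proof.
move=> us; set m := \sum_(i <- s) p i.
have m0 : 0 <= m by apply: sumr_ge0 => i _; exact: event_prob_ge0.
have h0 w : 0 <= hits s w by apply: sumr_ge0.
have mh := measurable_hits s.
have mX : measurable_fun setT (fun w => ((hits s w - m) ^+ 2)%:E).
  by apply/measurable_EFinP/measurable_funX/measurable_funB.
(* The negative cross term is moved to the other side, so only integrals of nonnegative functions
   are added. *)
have E1 : (\int[P]_w ((hits s w - m) ^+ 2)%:E + (2 * m * m)%:E =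
    \int[P]_w (hits s w ^+ 2)%:E + (m ^+ 2)%:E)%E.
  have -> : ((2 * m * m)%:E = \int[P]_w (2 * m * hits s w)%:E)%E.
    under eq_integral do rewrite EFinM.
    rewrite ge0_integralZl_EFin ?mulr_ge0//; last 2 first.
    - by move=> w _; rewrite lee_fin.
    - exact/measurable_EFinP.
    by rewrite integral_hits -EFinM.
  have -> : ((m ^+ 2)%:E = \int[P]_w (cst (m ^+ 2)%:E) w)%E.
    by rewrite integral_cst// [X in (_ * X)%E]probability_setT mule1.
  rewrite -!ge0_integralD//.
  - by apply: eq_integral => w _; rewrite -!EFinD; congr EFin; ring.
  - by move=> w _; rewrite lee_fin sqr_ge0.
  - by apply/measurable_EFinP/measurable_funX.
  - by move=> w _; rewrite lee_fin sqr_ge0.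
  - by move=> w _; rewrite lee_fin sqr_ge0.
  - by move=> w _; rewrite lee_fin !mulr_ge0.
  - by apply/measurable_EFinP/measurable_funM.
rewrite -(leeD2rE _ _ (isT : (2 * m * m)%:E \is a fin_num)) E1.
apply: le_trans (leeD2r _ (integral_hits_sqr us)) _.
by rewrite -!EFinD lee_fin -/m; lra.
Qed.

(* The mean square deviations are summable relative to [b ^+ 2], hence so are
   the squared relative deviations almost surely. *)
Lemma ae_hits_ratio (s : nat -> seq I) (b : nat -> R) (k K : R) :
  (forall L, uniq (s L)) -> (forall L, 0 < b L) ->
  (\sum_(0 <= L <oo) ((b L)^-1)%:E < +oo)%E ->
  (forall L, \sum_(i <- s L) p i <= K * b L) ->
  (fun L => (b L)^-1 * \sum_(i <- s L) p i) @ \oo --> k ->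
  {ae P, forall w, (fun L => (b L)^-1 * hits (s L) w) @ \oo --> k}.
Proof.
move=> us b0 bsum pb pk.
pose m L := \sum_(i <- s L) p i.
pose X L w := ((b L)^-1 * (hits (s L) w - m L)) ^+ 2.
have X0 L w : (0 <= (X L w)%:E)%E by rewrite lee_fin sqr_ge0.
have mX L : measurable_fun setT (fun w => (X L w)%:E).
  apply/measurable_EFinP/measurable_funX/measurable_funM => //.
  by apply: measurable_funB => //; exact: measurable_hits.
have K0 : 0 <= K.
  rewrite -(pmulr_lge0 _ (b0 0%N)); apply: le_trans (pb 0%N).
  by apply: sumr_ge0 => i _; exact: event_prob_ge0.
have intX L : (\int[P]_w (X L w)%:E <= K%:E * ((b L)^-1)%:E)%E.
  under eq_integral do rewrite /X exprMn EFinM.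
  rewrite ge0_integralZl_EFin ?sqr_ge0//; last 2 first.
  - by move=> w _; rewrite lee_fin sqr_ge0.
  - apply/measurable_EFinP/measurable_funX/measurable_funB => //.
    exact: measurable_hits.
  apply: (le_trans (lee_wpmul2l _ (second_moment_hits (us L)))).
    by rewrite lee_fin sqr_ge0.
  rewrite -!EFinM lee_fin -/(m L).
  apply: (le_trans (ler_wpM2l (sqr_ge0 _) (pb L))).
  by rewrite le_eqVlt; apply/orP; left; apply/eqP; field; rewrite gt_eqF.
(* Sum and integral are exchanged by nonnegativity; the means of [X L] are at most [K / b L]. Finite
   integral then gives a finite sum almost surely, so no passage to a subsequence of boxes is
   needed. *)
have sumfin : (\int[P]_w \sum_(0 <= L <oo) (X L w)%:E < +oo)%E.
  rewrite integral_nneseries//.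
  apply: (@le_lt_trans _ _ (\sum_(0 <= L <oo) K%:E * ((b L)^-1)%:E)%E).
    by apply: lee_nneseries => // L _ _; exact: integral_ge0.
  rewrite nneseriesZl; last by move=> L _; rewrite lee_fin invr_ge0 ltW.
  by rewrite lte_mul_pinfty ?lee_fin.
have sum_int : P.-integrable setT (fun w => \sum_(0 <= L <oo) (X L w)%:E)%E.
  apply/integrableP; split.
    by apply: ge0_emeasurable_sum => // L w _ _; exact: X0.
  under eq_integral do rewrite gee0_abs ?nneseries_ge0//.
  exact: sumfin.
have := integrable_ae measurableT sum_int.
apply: filterS => w /(_ Logic.I) Sfin.
have XL : (fun L => X L w) @ \oo --> 0.
  apply: cvg_nneseries_0 => [L|]; first exact: sqr_ge0.
  by rewrite -ge0_fin_numE// nneseries_ge0.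
have dL : (fun L => (b L)^-1 * (hits (s L) w - m L)) @ \oo --> 0.
  apply/cvgr0Pnorm_lt => e e0.
  move/cvgr0Pnorm_lt : XL => /(_ (e ^+ 2)); rewrite exprn_gt0// => /(_ isT).
  apply: filterS => L; rewrite /X normrX.
  by rewrite ltr_pXn2r// nnegrE ltW.
have -> : (fun L => (b L)^-1 * hits (s L) w) =
    (fun L => (b L)^-1 * (hits (s L) w - m L)) \+ (fun L => (b L)^-1 * m L).
  by apply/funext => L /=; rewrite -mulrDr subrK.
by rewrite -[k]add0r; exact: cvgD dL pk.
Qed.

End second_moment.

(** * Tails of the single-site law *)

Section power_tail.
Variables (R : realType) (delta : R).
Hypothesis delta1 : 1 < delta.

Lemma powRN_cvg0 (b : R) : 0 < b -> x `^ (- b) @[x --> +oo%R] --> 0.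
Proof.
move=> b0; apply/cvgr0Pnorm_lt => e e0.
near=> x.
have M0 : 0 < e `^ (- b^-1) by rewrite powR_gt0.
(* [e^(-1/b)] is the point at which [x^(-b)] equals [e]. *)
have Mx : e `^ (- b^-1) < x by near: x; apply: nbhs_pinfty_gt; rewrite num_real.
have x0 : 0 < x by exact: lt_trans Mx.
rewrite ger0_norm ?powR_ge0// powRN invf_plt ?posrE ?powR_gt0//.
have -> : e^-1 = (e `^ (- b^-1)) `^ b.
  by rewrite -powRrM mulNr mulVf ?gt_eqF// powR_inv1// ltW.
by rewrite gt0_ltr_powR// nnegrE ltW.
Unshelve. all: by end_near. Qed.

(** Agrees with [rho] from 1 on, but is continuous at every positive point, including 1 where [rho]
    jumps. *)
Let f (y : R) := (delta - 1) / 2 * y `^ (- delta).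

Lemma power_continuous (x : R) : 0 < x -> {for x, continuous f}.
Proof.
move=> x0; apply: cvgM; first exact: cvg_cst.
have : {for x, continuous (@powR R ^~ (- delta))}; last exact.
apply: differentiable_continuous; apply/derivable1_diffP.
by apply: derivable_powR; rewrite in_itv/= x0.
Qed.

(** The antiderivative [F] vanishes at infinity because [delta > 1]. *)
Lemma integral_power_tail (x : R) : 0 < x ->
  (\int[lebesgue_measure]_(y in `[x, +oo[) (f y)%:E =
   (1 / 2 * x `^ (- (delta - 1)))%:E)%E.
Proof.
move=> x0; pose F (y : R) : R := - (1 / 2) * y `^ (- (delta - 1)).
have dF (y : R) : 0 < y -> is_derive y (1 : R) F (f y).
  move=> y0.
  have -> : f y = - (1 / 2) *: (- (delta - 1) * y `^ (- (delta - 1) - 1)).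
    rewrite /f (_ : - (delta - 1) - 1 = - delta); last by ring.
    by rewrite -[_ *: _]/(_ * _); ring.
  by have := is_deriveZ (- (1 / 2)) (is_derive1_powR (- (delta - 1)) y0).
rewrite (@ge0_continuous_FTC2y _ _ F _ 0).
- by rewrite -EFinB sub0r /F mulNr opprK.
- by move=> y _; rewrite /f mulr_ge0 ?powR_ge0// divr_ge0// subr_ge0 ltW.
- apply/continuous_within_itvcyP; split.
    move=> y; rewrite in_itv/= andbT => xy.
    by apply: power_continuous; exact: lt_trans xy.
  exact/cvg_at_right_filter/power_continuous.
- rewrite -[0](mulr0 (- (1 / 2))); apply: cvgM; first exact: cvg_cst.
  by apply: powRN_cvg0; rewrite subr_gt0.
- by move=> y xy; have [] := dF y (lt_trans x0 xy).
- apply: cvg_at_right_filter; have : {for x, continuous F}; last exact.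
  apply: differentiable_continuous; apply/derivable1_diffP.
  by have [] := dF x x0.
- move=> y; rewrite in_itv/= andbT => xy; rewrite derive1E.
  by have [] := dF y (lt_trans x0 xy).
Qed.

Lemma integral_rho_right (x : R) : 1 <= x ->
  (\int[lebesgue_measure]_(y in `[x, +oo[) (rho delta y)%:E =
   (1 / 2 * x `^ (- (delta - 1)))%:E)%E.
Proof.
move=> x1; rewrite -integral_power_tail; last by lra.
apply: eq_integral => y; rewrite inE/= in_itv/= andbT => xy.
have y1 := le_trans x1 xy.
by rewrite /rho ger0_norm ?ltNge ?y1//; lra.
Qed.

Lemma integral_rho_left (x : R) : 1 <= x ->
  (\int[lebesgue_measure]_(y in `]-oo, (- x)%R]) (rho delta y)%:E =
   (1 / 2 * x `^ (- (delta - 1)))%:E)%E.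
Proof.
move=> x1; have x0 : 0 < x by lra.
rewrite -integral_power_tail//.
transitivity (\int[lebesgue_measure]_(y in `]-oo, (- x)%R]) ((f \o -%R) y)%:E)%E.
  apply: eq_integral => y; rewrite inE/= in_itv/= => yx.
  have y1 : 1 <= - y by lra.
  by rewrite /rho ler0_norm ?ltNge ?y1//; lra.
have cont (y : R) : y < 0 -> {for y, continuous (f \o -%R)}.
  move=> y0; apply: continuous_comp; first exact: opp_continuous.
  by apply: power_continuous; rewrite oppr_gt0.
rewrite ge0_integration_by_substitutionNy.
- by apply: eq_integral => y _ /=; rewrite opprK.
- apply/continuous_within_itvNycP; split.
    by move=> y; rewrite in_itv/= => yx; apply: cont; lra.
  by apply/cvg_at_left_filter/cont; lra.
- move=> y _ /=; apply: mulr_ge0; last exact: powR_ge0.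
  by rewrite divr_ge0// subr_ge0 ltW.
Qed.

End power_tail.

(** * Counting sites above a threshold *)

Lemma limn_esup_le (R : realType) (u v : (\bar R)^nat) :
  (forall n, u n <= v n)%E -> (limn_esup u <= limn_esup v)%E.
Proof.
move=> uv; rewrite !limn_esup_lim.
apply: lee_lim; [exact: is_cvg_esups|exact: is_cvg_esups|].
apply: nearW => n; apply: ge_ereal_sup => _ [m nm <-].
by apply: (le_trans (uv m)); apply: ereal_sup_ubound; exists m.
Qed.

Lemma limn_einf_le (R : realType) (u v : (\bar R)^nat) :
  (forall n, u n <= v n)%E -> (limn_einf u <= limn_einf v)%E.
Proof.
by move=> uv; rewrite leeN2; apply: limn_esup_le => n; rewrite leeN2.
Qed.

(** The liminf of [lo] and the limsup of [hi] are their limits, and both operations are monotone. *)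
Lemma limn_sandwich (R : realType) (lo u hi : R^nat) (l h : R) :
  (forall n, lo n <= u n <= hi n) -> lo @ \oo --> l -> hi @ \oo --> h ->
  [/\ (l%:E <= limn_einf (EFin \o u))%E,
      (limn_einf (EFin \o u) <= limn_esup (EFin \o u))%E &
      (limn_esup (EFin \o u) <= h%:E)%E].
Proof.
move=> luh lol hih.
have toE (v : R^nat) x : v @ \oo --> x -> (EFin \o v) @ \oo --> x%:E.
  by move=> vx; apply: cvg_EFin => //; exact: nearW.
split; last 2 first.
- exact: limn_einf_sup.
- rewrite -(cvg_limn_einf_sup (toE _ _ hih)).2; apply: limn_esup_le => n.
  by rewrite lee_fin; have /andP[] := luh n.
- rewrite -(cvg_limn_einf_sup (toE _ _ lol)).1; apply: limn_einf_le => n.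
  by rewrite lee_fin; have /andP[] := luh n.
Qed.

Section threshold_law.
Context (R : realType) (dsp : measure_display) (T : measurableType dsp)
  (P : probability T R) (d : nat) (alpha delta : R)
  (a : 'rV[int]_d -> R) (q : 'rV[int]_d -> {RV P >-> R}).
Hypotheses (hd : (2 <= d)%N) (alpha_gt0 : 0 < alpha) (delta1 : 1 < delta)
  (alpha_delta : alpha * (delta - 1) <= 1 / 2) (ha_pos : forall n, 0 < a n)
  (ha : decays_like a alpha) (hq_indep : independent_RVs q).

Lemma independent_pair (B : 'rV[int]_d -> set R) m n :
  (forall i, measurable (B i)) -> m != n ->
  P (q m @^-1` B m `&` q n @^-1` B n) =
  (P (q m @^-1` B m) * P (q n @^-1` B n))%E.
Proof.
move=> mB mn; have := hq_indep [fset m; n]%fset mB.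
rewrite big_fsetU1 ?inE//= big_seq_fset1 => <-; congr (P _).
apply/seteqP; split => w /=.
  by move=> [wm wn] i; rewrite /= !inE => /orP[] /eqP ->.
by move=> H; split; apply: H; rewrite /= !inE eqxx ?orbT.
Qed.

(** Stated for general [B] to serve both tails. The power law is asked for only when [a n <= c],
    since the tail of [rho] is constant below 1; as [a] tends to 0, this excludes finitely many
    sites. *)
Lemma ae_threshold (B : 'rV[int]_d -> set R) (c : R) : 0 < c ->
  (forall n, measurable (B n)) ->
  (forall n, 1 <= c / a n ->
    P (q n @^-1` B n) = (1 / 2 * (c / a n) `^ (- (delta - 1)))%:E) ->
  {ae P, forall w,
    (fun L => (beta a delta L)^-1 *
      hits R (fun n => q n @^-1` B n) (fset_set (box d L)) w) @ \oo -->
    1 / 2 * (1 / c `^ (delta - 1))}.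
Proof.
move=> c0 mB PB; set k := 1 / 2 * _.
pose p n := fine (P (q n @^-1` B n)).
have mA n : measurable (q n @^-1` B n) by exact: measurable_funPTI.
have pA n : P (q n @^-1` B n) = (p n)%:E.
  by rewrite /p fineK// fin_num_measure.
have betaE L : beta a delta L =
    \sum_(n <- fset_set (box d L)) a n `^ (delta - 1).
  by rewrite /beta fsbig_finite//=; exact: finite_box.
have tailE n : (c / a n) `^ (- (delta - 1)) =
    1 / c `^ (delta - 1) * a n `^ (delta - 1).
  rewrite powRN powRM ?(ltW c0) ?invr_ge0 ?(ltW (ha_pos n))//.
  rewrite -(powR_inv1 (ltW (ha_pos n))) -powRrM mulN1r powRN.
  by rewrite invfM invrK mul1r.
have p_small n : a n <= c -> p n = k * a n `^ (delta - 1).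
  move=> ac; rewrite /p PB; last by rewrite ler_pdivlMr ?mul1r.
  by rewrite /= tailE mulrA.
have k0 : 0 < k by rewrite mulr_gt0 ?divr_gt0 ?powR_gt0.
(* When [a n > c], the right side is [(a n / c)^(delta - 1) >= 1], which bounds any probability;
   this is the origin of the factor 2. *)
have pb n : p n <= 2 * k * a n `^ (delta - 1).
  have [ac|ca] := leP (a n) c.
    by rewrite p_small// ler_wpM2r ?powR_ge0// ler_peMl ?(ltW k0)// ler1n.
  apply: (@le_trans _ _ 1).
    by rewrite -lee_fin -pA probability_le1.
  have -> : 2 * k * a n `^ (delta - 1) = (c / a n) `^ (- (delta - 1)).
    by rewrite tailE /k; field; rewrite gt_eqF ?powR_gt0.
  rewrite powRN -[leLHS]invr1 lef_pV2 ?posrE ?powR_gt0 ?divr_gt0//.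
  have one : 1 = 1 `^ (delta - 1) :> R by rewrite powR1.
  rewrite [leRHS]one; apply: ge0_ler_powR.
  - by rewrite subr_ge0 ltW.
  - by rewrite nnegrE divr_ge0 ?(ltW c0) ?(ltW (ha_pos n)).
  - by rewrite nnegrE.
  - by rewrite ler_pdivrMr// mul1r ltW.
have sumb := summable_beta alpha_gt0 ha_pos ha hd delta1 alpha_delta.
have b0 := @beta_gt0 _ _ a delta ha_pos.
have [M aM] := decays_like_cvg0 alpha_gt0 ha c0.
(* The total deviation from the power law, independent of [L]: outside the box of size [M] the
   summand is zero. *)
pose D := \sum_(n <- fset_set (box d M)) (p n - k * a n `^ (delta - 1)).
have sumE L : (M <= L)%N ->
    \sum_(n <- fset_set (box d L)) p n = k * beta a delta L + D.
  move=> ML; rewrite betaE /D mulr_sumr.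
  rewrite [X in _ + X](@big_fset_incl _ _ _ _ _ (fset_set (box d L))) => [||n _].
  - by rewrite -big_split/=; apply: eq_bigr => n _; ring.
  - rewrite -fset_set_sub; [|exact: finite_box|exact: finite_box].
    by move=> n nM i; apply: (le_trans (nM i)); rewrite lez_nat.
  - rewrite in_fset_set; last exact: finite_box.
    move=> nM; rewrite p_small ?subrr//; apply: aM => nM'.
    by move: nM; rewrite mem_set.
apply: (@ae_hits_ratio _ _ _ _ _ _ p mA pA _ _ _ _ (2 * k)) => //.
- move=> m n mn; rewrite -[LHS]/(P _).
  by rewrite independent_pair// !pA.
- by move=> L; rewrite betaE mulr_sumr; apply: ler_sum => n _.
(* Summability of the inverses also shows that [beta] tends to infinity, so the contribution of [D]
   disappears. *)
- have bV : (fun L => (beta a delta L)^-1) @ \oo --> 0.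
    by apply: cvg_nneseries_0 => // L; rewrite invr_ge0 ltW.
  have : (fun L => k + (beta a delta L)^-1 * D) @ \oo --> k.
    rewrite -[X in _ --> X]addr0 -[X in _ --> _ + X](mul0r D).
    by apply: cvgD; [exact: cvg_cst|apply: cvgM => //; exact: cvg_cst].
  apply: cvg_trans; apply: near_eq_cvg; exists M => // L /= ML.
  by rewrite sumE// mulrDr mulrCA mulVf ?mulr1// gt_eqF.
Qed.

End threshold_law.

Lemma mem_preimage_itv (R : realType) (U : Type) (f : U -> R)
    (i : interval R) w :
  (w \in f @^-1` [set` i]) = (f w \in i).
Proof. by apply/idP/idP => [/set_mem//|fi]; apply/mem_set. Qed.

(** * Tail counts of the potential compared with eigenvalue counts *)

Section anderson_counts.
Context (R : realType) (dsp : measure_display) (T : measurableType dsp)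
  (P : probability T R) (d : nat) (alpha delta : R)
  (a : 'rV[int]_d -> R) (q : 'rV[int]_d -> {RV P >-> R}).
Hypotheses (hd : (2 <= d)%N) (alpha_gt0 : 0 < alpha) (delta1 : 1 < delta)
  (alpha_delta : alpha * (delta - 1) <= 1 / 2) (ha_pos : forall n, 0 < a n)
  (ha : decays_like a alpha) (hq_indep : independent_RVs q)
  (hq_law : forall n, has_density (q n) (rho delta)).

(** The event [a n * q n <= - c], solved for [q n] because that is the variable whose law is
    given. *)
Definition hits_le c := hits R (fun n => q n @^-1` `]-oo, (- (c / a n))%R]).
Definition hits_ge c := hits R (fun n => q n @^-1` `[(c / a n)%R, +oo[).

Lemma ae_hits_le (c : R) : 0 < c ->
  {ae P, forall w,
    (fun L => (beta a delta L)^-1 * hits_le c (fset_set (box d L)) w) @ \oo -->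
    1 / 2 * (1 / c `^ (delta - 1))}.
Proof.
move=> c0; apply: (ae_threshold hd alpha_gt0 delta1 alpha_delta ha_pos ha hq_indep)
  => // n ca.
by rewrite -(integral_rho_left delta1 ca); exact: hq_law.
Qed.

Lemma ae_hits_ge (c : R) : 0 < c ->
  {ae P, forall w,
    (fun L => (beta a delta L)^-1 * hits_ge c (fset_set (box d L)) w) @ \oo -->
    1 / 2 * (1 / c `^ (delta - 1))}.
Proof.
move=> c0; apply: (ae_threshold hd alpha_gt0 delta1 alpha_delta ha_pos ha hq_indep)
  => // n ca.
by rewrite -(integral_rho_right delta1 ca); exact: hq_law.
Qed.

Lemma hits_leE c s w : hits_le c s w = (\sum_(n <- s) (a n * q n w <= - c)%R)%N%:R.
Proof.
rewrite /hits_le /hits natr_sum; apply: eq_bigr => n _; rewrite indicE.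
rewrite mem_preimage_itv in_itv/=; congr (nat_of_bool _)%:R.
by rewrite -mulNr ler_pdivlMr// mulrC.
Qed.

Lemma hits_geE c s w : hits_ge c s w = (\sum_(n <- s) (c <= a n * q n w)%R)%N%:R.
Proof.
rewrite /hits_ge /hits natr_sum; apply: eq_bigr => n _; rewrite indicE.
rewrite mem_preimage_itv in_itv/= andbT; congr (nat_of_bool _)%:R.
by rewrite ler_pdivrMr// mulrC.
Qed.

(** Deterministic: hopping moves the counting threshold by at most [2d]. The shifted thresholds are
    expressed through their distance to 0 on the relevant side, for instance
    [E + 2d = - (- 2d - E)]. *)
Lemma anderson_counts w L (E : R) :
  [/\ (N_le a q w L E)%:R <= hits_le (- (2 * d%:R) - E) (fset_set (box d L)) w,
      hits_le (2 * d%:R - E) (fset_set (box d L)) w <= (N_le a q w L E)%:R,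
      (N_ge a q w L E)%:R <= hits_ge (E - 2 * d%:R) (fset_set (box d L)) w &
      hits_ge (2 * d%:R + E) (fset_set (box d L)) w <= (N_ge a q w L E)%:R].
Proof.
rewrite !hits_leE !hits_geE !ler_nat /N_le /N_ge /anderson.
pose v n := a n * q n w.
have [] := @eigen_count_diag_perturb R _ _ _ _ _ E
  (@schrodinger_boxE R d L v) (@hopping_sym R d L) (@hopping_bound R d L).
have cardE (p : pred R) : #|[set i | p ((\row_j v (@site d L j)) ord0 i)]%SET| =
    (\sum_(n <- fset_set (box d L)) p (v n))%N.
  rewrite -(card_site L (fun n => p (v n))).
  by apply: eq_card => i; rewrite !inE mxE.
rewrite (cardE (fun x => x <= E + 2 * d%:R)) (cardE (fun x => x <= E - 2 * d%:R)).
rewrite (cardE (fun x => E - 2 * d%:R <= x)) (cardE (fun x => E + 2 * d%:R <= x)).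
have -> : - (- (2 * d%:R) - E) = E + 2 * d%:R by ring.
have -> : - (2 * d%:R - E) = E - 2 * d%:R by ring.
by rewrite (addrC _ E).
Qed.

End anderson_counts.

Theorem theorem1p8 (R : realType) (dsp : measure_display)
    (T : measurableType dsp) (P : probability T R)
    (d : nat) (alpha delta : R)
    (a : 'rV[int]_d -> R) (q : 'rV[int]_d -> {RV P >-> R})
    (hd : (2 <= d)%N)
    (halpha : 0 < alpha < 1 / 2)
    (hdelta : 1 < delta < 1 / (2 * alpha))
    (ha_pos : forall n, 0 < a n)
    (ha : decays_like a alpha)
    (hq_indep : independent_RVs q)
    (hq_law : forall n, has_density (q n) (rho delta)) :
  (forall E : R, E < - (2 * d%:R) ->
    {ae P, forall w,
      [/\ ((1 / 2 * (1 / (2 * d%:R - E) `^ (delta - 1)))%:E <=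
            limn_einf (fun L => ((beta a delta L)^-1 *
                                 (N_le a q w L E)%:R)%:E))%E,
          (limn_einf (fun L => ((beta a delta L)^-1 *
                                (N_le a q w L E)%:R)%:E) <=
            limn_esup (fun L => ((beta a delta L)^-1 *
                                 (N_le a q w L E)%:R)%:E))%E &
          (limn_esup (fun L => ((beta a delta L)^-1 *
                                (N_le a q w L E)%:R)%:E) <=
            (1 / 2 * (1 / (- (2 * d%:R) - E) `^ (delta - 1)))%:E)%E]}) /\
  (forall E : R, 2 * d%:R < E ->
    {ae P, forall w,
      [/\ ((1 / 2 * (1 / (2 * d%:R + E) `^ (delta - 1)))%:E <=
            limn_einf (fun L => ((beta a delta L)^-1 *
                                 (N_ge a q w L E)%:R)%:E))%E,
          (limn_einf (fun L => ((beta a delta L)^-1 *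
                                (N_ge a q w L E)%:R)%:E) <=
            limn_esup (fun L => ((beta a delta L)^-1 *
                                 (N_ge a q w L E)%:R)%:E))%E &
          (limn_esup (fun L => ((beta a delta L)^-1 *
                                (N_ge a q w L E)%:R)%:E) <=
            (1 / 2 * (1 / (E - 2 * d%:R) `^ (delta - 1)))%:E)%E]}).
Proof.
have /andP[alpha_gt0 _] := halpha; have /andP[delta1 delta_lt] := hdelta.
(* From [2 alpha delta < 1] and [alpha > 0]. *)
have alpha_delta : alpha * (delta - 1) <= 1 / 2.
  move: delta_lt; rewrite ltr_pdivlMr ?mulr_gt0// => H; nra.
have d0 : 0 <= 2 * d%:R :> R by rewrite mulr_ge0.
have b0 L : 0 <= (beta a delta L)^-1 by rewrite invr_ge0 ltW// beta_gt0.
split=> E hE.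
(* The energy lies strictly beyond [2d] in absolute value, so both tail thresholds are positive;
   [c10] yields the upper bound and [c20] the lower one. *)
- have c10 : 0 < - (2 * d%:R) - E by lra.
  have c20 : 0 < 2 * d%:R - E by lra.
  have := ae_hits_le hd alpha_gt0 delta1 alpha_delta ha_pos ha hq_indep hq_law c10.
  have := ae_hits_le hd alpha_gt0 delta1 alpha_delta ha_pos ha hq_indep hq_law c20.
  apply: filterS2 => w lo hi; apply: limn_sandwich lo hi => L.
  have [up low _ _] := anderson_counts q ha_pos w L E.
  by rewrite !ler_wpM2l.
- have c10 : 0 < E - 2 * d%:R by lra.
  have c20 : 0 < 2 * d%:R + E by lra.
  have := ae_hits_ge hd alpha_gt0 delta1 alpha_delta ha_pos ha hq_indep hq_law c10.
  have := ae_hits_ge hd alpha_gt0 delta1 alpha_delta ha_pos ha hq_indep hq_law c20.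
  apply: filterS2 => w lo hi; apply: limn_sandwich lo hi => L.
  have [_ _ up low] := anderson_counts q ha_pos w L E.
  by rewrite !ler_wpM2l.
Qed.
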